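(* Let $n\geqslant 1$. A function $f\colon [0,1]^n\to\mathbb{R}$ is a nondecreasing multilinear polynomial function if and only if it satisfies $$ f(\mathbf{x}) ~=~ x_k\,\bigl(f(\mathbf{x}_k^1)\vee f(\mathbf{x}_k^0)\bigr)+\overline{x}_k\,\bigl(f(\mathbf{x}_k^1)\wedge f(\mathbf{x}_k^0)\bigr)\qquad\text{for all } \mathbf{x}\in [0,1]^n \text{ and all } k\in [n]. $$
   Context: Notation: $[n]=\{1,\ldots,n\}$; $\vee$ and $\wedge$ denote the maximum and minimum of real numbers; $\overline{x}_k=1-x_k$; for $\mathbf{x}=(x_1,\ldots,x_n)$, $\mathbf{x}_k^a$ is the $n$-tuple whose $i$-th coordinate is $a$ if $i=k$, and $x_i$ otherwise. A multilinear polynomial function $f\colon[0,1]^n\to\mathbb{R}$ is (the restriction to $[0,1]^n$ of) a real polynomial function of degree at most $1$ in each variable. A function $f$ is nondecreasing if, for every $\mathbf{x}$ and every $k\in[n]$, the map $z\mapsto f(\mathbf{x}_k^z)$ is isotone (order-preserving). *)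

(* Defs.v *)
From HB Require Import structures.
From mathcomp Require Import all_boot all_order all_algebra.
From mathcomp Require Import interval_inference reals.
From mathcomp Require Import mpoly.

Set Implicit Arguments.
Unset Strict Implicit.
Unset Printing Implicit Defensive.

Import Order.TTheory GRing.Theory Num.Theory.

Local Open Scope ring_scope.

(* Points of [0,1]^n; the coordinates are numbered 0, ..., n-1. *)
Definition cube (R : realType) (n : nat) := {ffun 'I_n -> {i01 R}}.

Definition subst_coord (R : realType) (n : nat) (x : cube R n) (k : 'I_n)
    (a : {i01 R}) : cube R n :=
  [ffun i => if i == k then a else x i].

Definition multilinear_polynomial (R : realType) (n : nat)
    (f : cube R n -> R) : Prop :=
  exists2 p : {mpoly R[n]},
    forall (m : 'X_{1..n}) (i : 'I_n), m \in msupp p -> (m i <= 1)%N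
  & forall x : cube R n, f x = p.@[fun i => (x i)%:num].

Definition nondecreasing_coord (R : realType) (n : nat)
    (f : cube R n -> R) : Prop :=
  forall (x : cube R n) (k : 'I_n),
    {homo (fun z : {i01 R} => f (subst_coord x k z)) : z1 z2 / z1 <= z2}.

(* Main.v *)
Require Import Defs.
From HB Require Import structures.
From mathcomp Require Import all_boot all_order all_algebra.
From mathcomp Require Import interval_inference reals.
From mathcomp Require Import mpoly.
From mathcomp Require Import ring lra.

(** For both directions, the displayed identity is compared with the
    interpolation formula

      f x = x_k f(x_k^1) + (1 - x_k) f(x_k^0),

    which says that f is affine in each coordinate separately. The two
    identities agree as soon as f(x_k^0) <= f(x_k^1).

    A monomial of degree at most 1 in its k-th variable satisfies the
    interpolation formula, hence so does a multilinear polynomial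
    ([meval_interpolation]), and monotonicity says which of the two endpoint
    values is the maximum.

    Conversely, let f satisfy the identity with max and min. Neither x_k^1 nor
    x_k^0 depends on x_k, so the identity describes f on a whole segment
    parallel to the k-th axis: it is affine there, with slope max - min >= 0.
    This gives monotonicity and, the maximum being reached at the end x_k = 1,
    the interpolation formula ([max_min_nondecreasing],
    [nondecreasing_interpolation]). Using the formula once for each coordinate
    turns f into a polynomial: each step adds to the polynomials obtained so
    far one factor X_k, of a variable that does not occur in them yet
    ([interpolation_mpoly]). *)

Set Implicit Arguments.
Unset Strict Implicit.
Unset Printing Implicit Defensive.

Import Order.TTheory GRing.Theory Num.Theory.

Local Open Scope ring_scope.

Lemma subst_coordK (R : realType) (n : nat) (x : cube R n) (k : 'I_n)
    (a b : {i01 R}) :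
  subst_coord (subst_coord x k a) k b = subst_coord x k b.
Proof. by apply/ffunP => i; rewrite !ffunE; case: eqP. Qed.

Definition splice (R : realType) (n : nat) (s : seq 'I_n) (y x : cube R n) :
  cube R n := [ffun i => if i \in s then y i else x i].

(** This is the induction step on the list of free coordinates: an endpoint of
    the interpolation in the [k]-th direction has one free coordinate fewer, at
    the price of another base point. *)
Lemma subst_coord_splice (R : realType) (n : nat) (k : 'I_n) (s : seq 'I_n)
    (y x : cube R n) (a : {i01 R}) :
  k \notin s ->
  subst_coord (splice (k :: s) y x) k a = splice s y (subst_coord x k a).
Proof.
move=> ks; apply/ffunP => i; rewrite !ffunE in_cons.
by case: eqVneq => // ->; rewrite (negbTE ks).
Qed.

Definition interpolation (R : realType) (n : nat) (f : cube R n -> R) : Prop :=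
  forall (x : cube R n) (k : 'I_n),
    f x = (x k)%:num * f (subst_coord x k 1%:i01)
        + (1 - (x k)%:num) * f (subst_coord x k 0%:i01).

(** Each monomial is, as a function of the [k]-th variable, either constant or
    linear, and both kinds of functions are determined by their values at 0 and
    1 through the formula. *)
Lemma meval_interpolation (R : comNzRingType) (n : nat) (p : {mpoly R[n]})
    (k : 'I_n) (v v1 v0 : 'I_n -> R) :
  (forall m : 'X_{1..n}, m \in msupp p -> (m k <= 1)%N) ->
  (forall i, i != k -> v1 i = v i) -> v1 k = 1 ->
  (forall i, i != k -> v0 i = v i) -> v0 k = 0 ->
  p.@[v] = v k * p.@[v1] + (1 - v k) * p.@[v0].
Proof.
move=> pk v1E v1k v0E v0k; rewrite !mevalE !mulr_sumr -big_split /=.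
apply: eq_big_seq => m /pk mk.
have prodE w : (forall i, i != k -> w i = v i) ->
    \prod_i w i ^+ m i = w k ^+ m k * \prod_(i | i != k) v i ^+ m i.
  by move=> wE; rewrite (bigD1 k) //=; congr (_ * _);
    apply: eq_bigr => i /wE ->.
rewrite (prodE v1) // (prodE v0) // (prodE v) // v1k v0k.
case: (m k) mk => [|[|//]] _; rewrite ?expr0 ?expr1; ring.
Qed.

Lemma multilinear_interpolation (R : realType) (n : nat) (f : cube R n -> R) :
  multilinear_polynomial f -> interpolation f.
Proof.
case=> p p1 fE x k; rewrite !fE.
apply: meval_interpolation => [m /p1 //|i ik||i ik|].
- by rewrite ffunE (negbTE ik).
- by rewrite ffunE eqxx.
- by rewrite ffunE (negbTE ik).
- by rewrite ffunE eqxx.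
Qed.

(** A variable that is absent from [p] and [q] occurs only to the first power
    in a combination of them that is affine in it. *)
Lemma msupp_affine (R : comNzRingType) (n : nat) (k : 'I_n) (s : seq 'I_n)
    (p q : {mpoly R[n]}) :
  k \notin s ->
  (forall m i, m \in msupp p -> (m i <= (i \in s))%N) ->
  (forall m i, m \in msupp q -> (m i <= (i \in s))%N) ->
  forall m i, m \in msupp ('X_k * p + q) -> (m i <= (i \in k :: s))%N.
Proof.
move=> ks ps qs m i /msuppD_le; rewrite mem_cat in_cons => /orP[|mq].
  rewrite mulrC (perm_mem (msuppMX _ _)) => /mapP[m' /ps m's ->].
  rewrite mnmDE mnm1E; have := m's i; rewrite eq_sym.
  by case: eqVneq => [->|_] //=; rewrite (negbTE ks) leqn0 => /eqP ->.
by apply: leq_trans (qs m i mq) _; case: (i \in s); rewrite ?orbT.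
Qed.

(** With only the coordinates in [s] free, a function that is affine in each
    coordinate is a polynomial in the corresponding variables. A further free
    coordinate [k] interpolates linearly between the polynomials obtained for
    the values 0 and 1 of that coordinate, which is why the base point [x] has
    to vary in the induction. The bound on the exponents also records that the
    variables outside [s] are absent: this keeps the degree in the [k]-th
    variable at most 1 after the multiplication by it. *)
Lemma interpolation_mpoly (R : realType) (n : nat) (f : cube R n -> R)
    (s : seq 'I_n) (x : cube R n) :
  interpolation f -> uniq s ->
  exists2 p : {mpoly R[n]},
    forall (m : 'X_{1..n}) (i : 'I_n), m \in msupp p -> (m i <= (i \in s))%N
  & forall y : cube R n, f (splice s y x) = p.@[fun i => (y i)%:num].
Proof.
move=> fI; elim: s x => [|k s IHs] x => [_|/= /andP[ks /IHs{}IHs]].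
  exists (f x)%:MP => [m i|y].
    by rewrite msuppC; case: eqP => // _; rewrite inE => /eqP ->; rewrite mnm0E.
  by rewrite mevalC; congr f; apply/ffunP => i; rewrite ffunE.
have [p1 p1s p1E] := IHs (subst_coord x k 1%:i01).
have [p0 p0s p0E] := IHs (subst_coord x k 0%:i01).
exists ('X_k * (p1 - p0) + p0) => [|y].
  apply: msupp_affine => // m i /msuppB_le.
  by rewrite mem_cat => /orP[/p1s|/p0s].
rewrite (fI _ k) !subst_coord_splice // p1E p0E ffunE mem_head.
by rewrite mevalD mevalM mevalB mevalXU; ring.
Qed.

Lemma interpolation_multilinear (R : realType) (n : nat) (f : cube R n -> R) :
  interpolation f -> multilinear_polynomial f.
Proof.
move=> fI.
have [p ps pE] :=
  interpolation_mpoly [ffun=> 0%:i01] fI (enum_uniq 'I_n).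
exists p => [m i mp|x]; first by have := ps m i mp; rewrite mem_enum.
by rewrite -pE; congr f; apply/ffunP => i; rewrite ffunE mem_enum.
Qed.

Lemma nondecreasing_ends (R : realType) (n : nat) (f : cube R n -> R)
    (x : cube R n) (k : 'I_n) :
  nondecreasing_coord f ->
  f (subst_coord x k 0%:i01) <= f (subst_coord x k 1%:i01).
Proof. by move=> fN; apply: fN; rewrite -num_le /= ler01. Qed.

Definition max_min_interpolation (R : realType) (n : nat)
    (f : cube R n -> R) : Prop :=
  forall (x : cube R n) (k : 'I_n),
    f x =
      (x k)%:num * Num.max (f (subst_coord x k 1%:i01))
                           (f (subst_coord x k 0%:i01))
      + (1 - (x k)%:num) * Num.min (f (subst_coord x k 1%:i01))
                                   (f (subst_coord x k 0%:i01)).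

(** Monotonicity gives f(x_k^0) <= f(x_k^1), so that the maximum and the minimum
    are the values at x_k^1 and x_k^0 respectively. *)
Lemma nondecreasing_interpolation (R : realType) (n : nat)
    (f : cube R n -> R) :
  nondecreasing_coord f -> interpolation f <-> max_min_interpolation f.
Proof.
by move=> fN; split=> fE x k; have := fE x k;
  rewrite (max_l (nondecreasing_ends x k fN)) (min_r (nondecreasing_ends x k fN)).
Qed.

(** On a segment parallel to the [k]-th axis the two endpoint values are
    constants, so the right-hand side is affine in the [k]-th coordinate, with
    slope the maximum minus the minimum. *)
Lemma max_min_nondecreasing (R : realType) (n : nat) (f : cube R n -> R) :
  max_min_interpolation f -> nondecreasing_coord f.
Proof.
move=> fE x k z1 z2; rewrite -num_le /= => z12.
rewrite (fE (subst_coord x k z1) k) (fE (subst_coord x k z2) k).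
rewrite !subst_coordK !ffunE eqxx.
set M := Num.max _ _; set m := Num.min _ _.
have mM : m <= M by rewrite /m /M ge_min le_max lexx.
by nra.
Qed.

Theorem proposition1p3 (R : realType) (n : nat) (hn : (1 <= n)%N)
    (f : cube R n -> R) :
  (multilinear_polynomial f /\ nondecreasing_coord f) <->
  (forall (x : cube R n) (k : 'I_n),
     f x =
       (x k)%:num * Num.max (f (subst_coord x k 1%:i01))
                            (f (subst_coord x k 0%:i01))
       + (1 - (x k)%:num) * Num.min (f (subst_coord x k 1%:i01))
                                    (f (subst_coord x k 0%:i01))).
Proof.
split=> [[fM fN]|fE].
  exact/(nondecreasing_interpolation fN)/multilinear_interpolation.
have fN := max_min_nondecreasing fE.
split=> //.
exact/interpolation_multilinear/(nondecreasing_interpolation fN).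
Qed.
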